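(* Given a dataset $S$ and deletion requests $U\subseteq S$, let $\mathfrak C(S)$ denote the subset of points of $S$ whose labels are queried by $\mathrm{BBQSampler}$ in the algorithm $\mathsf{Alg}$ (BBQSampler followed by DeletionUpdate, as defined in the context), and let $\mathsf{Alg}(S,U)$ denote the unlearned model. Then $\mathsf{Alg}$ is an exact system-aware unlearning algorithm with $S'=\mathfrak C(S)$ and state-of-system $\mathsf I(S,U)=(\mathsf{Alg}(S,U),\,\mathfrak C(S)\setminus U)$. In particular, it satisfies the definition of system-aware-$(\varepsilon,\delta)$-unlearning with $\varepsilon=\delta=0$.
   Context: Setting: binary linear classification. $S=((x_1,y_1),\dots,(x_T,y_T))$ is a dataset of size $T=|S|$ with $x_t\in\mathbb R^d$, $\|x_t\|\le 1$, $y_t\in\{+1,-1\}$, and there is $u\in\mathbb R^d$, $\|u\|\le1$, with $\mathbb E[y_t\mid x_t]=u^\top x_t$. Algorithm $\mathsf{Alg}$. Inputs: a dataset $S$ of size $T$, deletion requests $U$, a deletion capacity $K>0$, and a sampling parameter $0\le\kappa\le1$. (1) $\mathrm{BBQSampler}(S,K,\kappa)$: set $\lambda=K$, $A_0=\lambda I$, $b_0=0$, $w_0=0$, $\mathcal Q=\emptyset$. For $t=1,\dots,T$: if $x_t^\top A_{t-1}^{-1}x_t>T^{-\kappa}$, query $y_t$ and set $A_t=A_{t-1}+x_tx_t^\top$, $b_t=b_{t-1}+y_tx_t$, $w_t=A_t^{-1}b_t$, $\mathcal Q\leftarrow\mathcal Q\cup\{(x_t,y_t)\}$; otherwise set $A_t=A_{t-1}$,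 $b_t=b_{t-1}$, $w_t=w_{t-1}$. Return $\mathcal Q,A_T,b_T,w_T$. The core set $\mathfrak C(S)$ is the returned set $\mathcal Q$ of queried points. (2) $\mathrm{DeletionUpdate}$: starting from $A=A_T$, $b=b_T$, $w=w_T$, for each $(x,y)\in U$ with $(x,y)\in\mathcal Q$, remove $(x,y)$ from $\mathcal Q$ and set $A\leftarrow A-xx^\top$, $b\leftarrow b-yx$, $w\leftarrow A^{-1}b$. The returned model is $x\mapsto\mathrm{sign}(w^\top x)$. Definition. For a (possibly randomized) learning-unlearning algorithm $A$, the state-of-system $\mathsf I_A(S,U)$ is what is stored in the system after learning on $S$ and processing the deletion requests $U$. $A$ is system-aware-$(\varepsilon,\delta)$-unlearning if for all $S$ there exists $S'\subseteq S$ such that for all $U\subseteq S$ and all measurable sets $F$: $\Pr(\mathsf I_A(S,U)\in F)\le e^\varepsilon\Pr(\mathsf I_A(S'\setminus U,\emptyset)\in F)+\delta$ and $\Pr(\mathsf I_A(S'\setminus U,\emptyset)\in F)\le e^\varepsilon\Pr(\mathsf I_A(S,U)\in F)+\delta$. It is an exact system-aware unlearning algorithm if this holds with $\varepsilon=\delta=0$.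
   Formalization: The run of the algorithm on S'\U keeps T = |S| in the threshold T^{-κ}; if T were recomputed as |S'\U|, the claim would fail (e.g. d=1, K=κ=1, S=((1,+1),(0,y)), U=∅). *)

(* Defs.v *)
From HB Require Import structures.
From mathcomp Require Import all_boot all_order all_algebra.
From mathcomp Require Import all_classical all_reals all_analysis.

Set Implicit Arguments.
Unset Strict Implicit.
Unset Printing Implicit Defensive.

Import Order.TTheory GRing.Theory Num.Theory.

Local Open Scope classical_set_scope.
Local Open Scope ring_scope.

(* A dataset is a sequence (BBQSampler depends on the order of the points), in
   which repetitions are allowed.  Inclusion and difference of collections of
   data points are therefore taken with multiplicity; when [S] is
   duplicate-free they are the usual set operations. *)
Section Collections.
Variable X : eqType.
Implicit Types S U : seq X.

Definition submultiset U S : Prop := forall p, (count_mem p U <= count_mem p S)%N.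

Definition mdiff S U : seq X := foldl (fun s p => rem p s) S U.

End Collections.

(* System-aware unlearning of a possibly randomized algorithm: [I S U] is the law
   of the state-of-system after learning on [S] and deleting [U], and [D] is the
   class of datasets on which the guarantee is required. *)
Section SystemAware.
Context (R : realType) (X : eqType) (disp : measure_display)
        (Z : measurableType disp).
Implicit Types (I : seq X -> seq X -> probability Z R) (D : set (seq X))
               (C : seq X -> seq X).

Definition unlearning_guarantee I (S S' : seq X) (eps delta : R) : Prop :=
  forall U, submultiset U S -> forall F : set Z, measurable F ->
    (I S U F <= (expR eps)%:E * I (mdiff S' U) [::] F + delta%:E)%E /\
    (I (mdiff S' U) [::] F <= (expR eps)%:E * I S U F + delta%:E)%E.

(* A sub-dataset [S'] inherits the order of [S], hence [subseq]. *)
Definition system_aware_unlearning D I (eps delta : R) : Prop :=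
  forall S, D S ->
    exists2 S', subseq S' S & unlearning_guarantee I S S' eps delta.

Definition exact_system_aware_unlearning_with D I C : Prop :=
  forall S, D S -> subseq (C S) S /\ unlearning_guarantee I S (C S) 0 0.

End SystemAware.

Section BBQ.
Context (R : realType) (d : nat).

(* The library norm on matrices is the sup norm, so the Euclidean one is
   defined here. *)
Definition dotv (u v : 'cV[R]_d) : R := (u^T *m v) 0 0.
Definition enorm (u : 'cV[R]_d) : R := Num.sqrt (dotv u u).

(* The Boolean [y] encodes the label [label y] in {+1, -1}. *)
Definition label (y : bool) : R := if y then 1 else -1.

Local Notation datum := ('cV[R]_d * bool)%type.

(* Datasets of size [T] allowed by the setting.  [law x] is the conditional law
   of a label given its instance [x]; the labels of [S] are outcomes of positive
   conditional probability. *)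
Definition setting (T : nat) : set (seq datum) := [set S |
  [/\ size S = T,
      forall p, p \in S -> enorm p.1 <= 1 &
      exists2 u : 'cV[R]_d, enorm u <= 1 &
      exists law : 'cV[R]_d -> probability bool R,
        forall p, p \in S ->
          ('E_(law p.1)[label] = (dotv u p.1)%:E /\ 0 < law p.1 [set p.2])%E]].

Record system := System {
  sys_Q : seq datum; sys_A : 'M[R]_d; sys_b : 'cV[R]_d; sys_w : 'cV[R]_d }.

(* A state of the system: a model and a stored collection of data points. *)
Definition state : Type := (('cV[R]_d -> R) * seq datum)%type.
HB.instance Definition _ := Choice.copy state (('cV[R]_d -> R) * seq datum)%type.
HB.instance Definition _ := isPointed.Build state (fun=> 0, [::]).

(* [T] is a parameter of the algorithm, and not recomputed as the size of
   the sequence being processed: for a dataset [S] it is the size of [S], and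
   the run on the remaining core points that defines unlearning uses the same
   threshold [T ^ - kappa].  With the size recomputed, that run could stop
   querying core points: for K = kappa = 1 and instances 1, 0 in dimension 1,
   the core set is the first point (1 > 1/2), which is not queried when run
   alone (1 > 1 fails). *)
Section Algorithm.
Variables (T : nat) (K kappa : R).

Definition bbq_step (s : system) (p : datum) : system :=
  let x := p.1 in let y := label p.2 in
  if T%:R `^ (- kappa) < dotv x (invmx (sys_A s) *m x) then
    let A := sys_A s + x *m x^T in
    let b := sys_b s + y *: x in
    System (rcons (sys_Q s) p) A b (invmx A *m b)
  else s.

Definition bbq_sampler (S : seq datum) : system :=
  foldl bbq_step (System [::] K%:M 0 0) S.

Definition core_set (S : seq datum) : seq datum := sys_Q (bbq_sampler S).

Definition deletion_step (s : system) (p : datum) : system :=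
  let x := p.1 in let y := label p.2 in
  if p \in sys_Q s then
    let A := sys_A s - x *m x^T in
    let b := sys_b s - y *: x in
    System (rem p (sys_Q s)) A b (invmx A *m b)
  else s.

Definition deletion_update (s : system) (U : seq datum) : system :=
  foldl deletion_step s U.

Definition alg (S U : seq datum) : 'cV[R]_d -> R :=
  fun x => Num.sg (dotv (sys_w (deletion_update (bbq_sampler S) U)) x).

Definition state_of_system (S U : seq datum) : state :=
  (alg S U, mdiff (core_set S) U).

(* The algorithm is deterministic, so its state has a Dirac law.  The
   sigma-algebra on states is the one generated by an arbitrary family [G]. *)
Definition state_law (G : set (set state)) (S U : seq datum) :
    probability (g_sigma_algebraType G) R :=
  @dirac _ (g_sigma_algebraType G) (state_of_system S U) R.

End Algorithm.
End BBQ.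

(* Main.v *)
Require Import Defs.
From mathcomp Require Import all_boot all_order all_algebra.
From mathcomp Require Import all_classical all_reals all_analysis.
From mathcomp Require Import lra.

Import Order.TTheory GRing.Theory Num.Theory.

Local Open Scope classical_set_scope.
Local Open Scope ring_scope.

(** Every state reached by the algorithm is a function of its query set alone,
    namely ridge regression on it, and deletion commutes with this description.
    So both systems of the theorem agree as soon as the sampler, run on a
    subsequence of the core set, queries all of it.  This holds because dropping
    points decreases the Gram matrix in the Loewner order, hence increases
    [x^T A^-1 x], so a core point stays above the threshold. *)

Section EuclideanForm.
Set Implicit Arguments.
Unset Strict Implicit.
Variables (R : realType) (d : nat).
Implicit Types (u v x : 'cV[R]_d) (A B : 'M[R]_d).

Lemma dotvC u v : dotv u v = dotv v u.
Proof. by rewrite /dotv !mxE; apply: eq_bigr => i _; rewrite !mxE mulrC. Qed.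

Lemma dotvDr u v x : dotv u (v + x) = dotv u v + dotv u x.
Proof. by rewrite /dotv mulmxDr mxE. Qed.

Lemma dotvNr u v : dotv u (- v) = - dotv u v.
Proof. by rewrite /dotv mulmxN mxE. Qed.

Lemma dotvZr a u v : dotv u (a *: v) = a * dotv u v.
Proof. by rewrite /dotv -scalemxAr mxE. Qed.

Lemma dotv0r u : dotv u 0 = 0.
Proof. by rewrite /dotv mulmx0 mxE. Qed.

Lemma dotv_gt0 v : v != 0 -> 0 < dotv v v.
Proof.
have nonneg i : 0 <= v^T 0 i * v i 0 by rewrite mxE -expr2 sqr_ge0.
rewrite /dotv mxE lt0r sumr_ge0 // andbT; apply: contraNneq => /eqP.
rewrite psumr_eq0 // => /allP v0; apply/eqP/colP => i; rewrite !mxE.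
by have := v0 i (mem_index_enum i); rewrite mxE -expr2 sqrf_eq0 => /eqP.
Qed.

Lemma dotv_mulmx u v A : dotv u (A *m v) = dotv (A^T *m u) v.
Proof. by rewrite /dotv trmx_mul trmxK mulmxA. Qed.

Lemma dotv_outer v x : dotv v ((x *m x^T) *m v) = dotv v x ^+ 2.
Proof.
by rewrite -mulmxA [x^T *m v]mx11_scalar mul_mx_scalar dotvZr [X in X * _]dotvC.
Qed.

(** Symmetry is required separately: over the reals, a positive quadratic form does not imply it. *)
Definition posdefmx A := A^T = A /\ forall v, v != 0 -> 0 < dotv v (A *m v).

Lemma posdefmx_ge0 A v : posdefmx A -> 0 <= dotv v (A *m v).
Proof.
case=> _ A_gt0; have [->|/A_gt0/ltW//] := eqVneq v 0.
by rewrite mulmx0 dotv0r.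
Qed.

(** By symmetry, the transpose of a left null vector is a null vector, on which the form would
    vanish. *)
Lemma posdefmx_unit A : posdefmx A -> A \in unitmx.
Proof.
case=> AT A_gt0; rewrite -row_free_unit -kermx_eq0; apply/rowV0P => v.
move=> /sub_kermxP vA; apply: contraTeq isT => v0.
have /A_gt0 : v^T != 0 by rewrite trmx_eq0.
by rewrite -AT -trmx_mul vA trmx0 dotv0r ltxx.
Qed.

(** With [v = A^-1 x] and [w = B^-1 x], positivity of [B] gives [0 <= x^T w - 2 x^T v + v^T B v],
    and the last term is at most [v^T A v = x^T v]. *)
Lemma le_invmx_form A B x : posdefmx A -> posdefmx B ->
  (forall v, dotv v (B *m v) <= dotv v (A *m v)) ->
  dotv x (invmx A *m x) <= dotv x (invmx B *m x).
Proof.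
move=> pA pB leBA.
set v := invmx A *m x; set w := invmx B *m x.
have Av : A *m v = x by rewrite mulKVmx // posdefmx_unit.
have Bw : B *m w = x by rewrite mulKVmx // posdefmx_unit.
have := leBA v; rewrite Av.
(* Expand [0 <= (w - v)^T B (w - v)]. *)
have := posdefmx_ge0 (w - v) pB.
rewrite mulmxBr Bw dotvDr dotvNr ![dotv (w - v) _]dotvC !dotvDr !dotvNr.
have -> : dotv (B *m v) w = dotv x v by rewrite dotvC dotv_mulmx pB.1 Bw.
rewrite [dotv (B *m v) v]dotvC [dotv v x]dotvC; lra.
Qed.

End EuclideanForm.

Section Ridge.
Set Implicit Arguments.
Unset Strict Implicit.
Variables (R : realType) (d : nat) (K : R).
Local Notation datum := ('cV[R]_d * bool)%type.
Implicit Types (Q C S U : seq datum) (p : datum).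

Definition gram Q : 'M[R]_d := K%:M + \sum_(p <- Q) p.1 *m p.1^T.

Definition moment Q : 'cV[R]_d := \sum_(p <- Q) label R p.2 *: p.1.

(** For [K > 0] the last field minimizes [K |w|^2] plus the sum of the squared errors
    [(w^T x - y)^2] over [Q]. *)
Definition ridge Q : system R d :=
  System Q (gram Q) (moment Q) (invmx (gram Q) *m moment Q).

Lemma gram_form Q v :
  dotv v (gram Q *m v) = K * dotv v v + \sum_(p <- Q) dotv v p.1 ^+ 2.
Proof.
rewrite /gram mulmxDl dotvDr mul_scalar_mx dotvZr; congr (_ + _).
elim: Q => [|p Q IH]; first by rewrite !big_nil mul0mx dotv0r.
by rewrite !big_cons mulmxDl dotvDr dotv_outer IH.
Qed.

Lemma gram_form_subseq Q Q' v : subseq Q' Q ->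
  dotv v (gram Q' *m v) <= dotv v (gram Q *m v).
Proof.
rewrite !gram_form lerD2l => /subseqP[m _ ->] {Q'}.
elim: Q m => [|p Q IH] [|[] m] /=; rewrite ?big_nil ?big_cons ?lerD2l ?IH //.
- by rewrite addr_ge0 ?sqr_ge0 ?sumr_ge0 // => q _; rewrite sqr_ge0.
- by rewrite (le_trans (IH m)) // lerDr sqr_ge0.
Qed.

Lemma posdefmx_gram Q : 0 < K -> posdefmx (gram Q).
Proof.
move=> K_gt0; split=> [|v v0].
  rewrite /gram linearD /= tr_scalar_mx raddf_sum; congr (_ + _).
  by apply: eq_bigr => p _; rewrite /= trmx_mul trmxK.
(* Compare with the empty query set, whose Gram matrix is [K I]. *)
apply: lt_le_trans (gram_form_subseq v (sub0seq Q)).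
by rewrite gram_form big_nil addr0 mulr_gt0 // dotv_gt0.
Qed.

Lemma ridge_nil : ridge [::] = System [::] K%:M 0 0.
Proof. by rewrite /ridge /gram /moment !big_nil addr0 mulmx0. Qed.

Lemma bbq_step_ridge T kappa Q p :
  bbq_step T kappa (ridge Q) p =
  if T%:R `^ (- kappa) < dotv p.1 (invmx (gram Q) *m p.1)
  then ridge (rcons Q p) else ridge Q.
Proof.
rewrite /bbq_step /=; case: ifP => // _.
by rewrite /ridge /gram /moment -cats1 !big_cat !big_seq1 addrA.
Qed.

(** Both sums ignore order, so subtracting the term of [p] leaves the sums over [rem p Q]; if [p] is
    absent, [rem] changes nothing, as in the algorithm. *)
Lemma deletion_step_ridge Q p : deletion_step (ridge Q) p = ridge (rem p Q).
Proof.
rewrite /deletion_step /=; case: ifPn => [pQ|/rem_id-> //].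
rewrite /ridge; have -> : gram Q - p.1 *m p.1^T = gram (rem p Q).
  by rewrite /gram (perm_big _ (perm_to_rem pQ)) big_cons addrCA addrAC subrr add0r.
have -> // : moment Q - label R p.2 *: p.1 = moment (rem p Q).
by rewrite /moment (perm_big _ (perm_to_rem pQ)) big_cons addrAC subrr add0r.
Qed.

Lemma deletion_update_ridge Q U : deletion_update (ridge Q) U = ridge (mdiff Q U).
Proof. by elim: U Q => //= p U IH Q; rewrite deletion_step_ridge IH. Qed.

(** [C] collects the points queried from [S]. The replay clause also lets the starting set shrink to
    [Q'], because a point dropped from [C] stays missing for the rest of the run. *)
Lemma foldl_bbq_step_ridge T kappa Q S : 0 < K ->
  exists C, [/\ foldl (bbq_step T kappa) (ridge Q) S = ridge (Q ++ C),
    subseq C S &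
    forall Q' C', subseq Q' Q -> subseq C' C ->
      foldl (bbq_step T kappa) (ridge Q') C' = ridge (Q' ++ C')].
Proof.
move=> K_gt0; elim: S Q => [|p S IH] Q /=.
  by exists [::]; split; rewrite ?cats0 // => Q' C' _ /eqP->; rewrite cats0.
rewrite bbq_step_ridge; case: ifPn => [queried|_]; last first.
  have [C [eqC subC HC]] := IH Q; exists C; split => //.
  exact: subseq_trans subC (subseq_cons _ _).
have [C [eqC subC HC]] := IH (rcons Q p).
exists (p :: C); split=> [||Q' C' subQ].
- by rewrite eqC cat_rcons.
- by rewrite /= eqxx.
(* If the replay omits [p], then [Q'] still lies inside the larger set [rcons Q p]. *)
have drop_p : subseq C' C ->
    foldl (bbq_step T kappa) (ridge Q') C' = ridge (Q' ++ C').
  by apply: HC; apply: subseq_trans subQ (subseq_rcons _ _).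
case: C' drop_p => [|q C'] drop_p; first by rewrite /= cats0.
move=> /=; case: eqP => [-> subC'|_]; last exact: drop_p.
(* The replay keeps [p]: it passed the threshold against [gram Q], and [gram Q'] is smaller in the
   Loewner order. *)
rewrite bbq_step_ridge ifT; last first.
  apply: lt_le_trans queried _; apply: le_invmx_form.
  - exact: posdefmx_gram.
  - exact: posdefmx_gram.
  - by move=> v; apply: gram_form_subseq.
rewrite HC ?cat_rcons // -!cats1; exact: cat_subseq.
Qed.

Lemma bbq_sampler_ridge T kappa S : 0 < K ->
  bbq_sampler T K kappa S = ridge (core_set T K kappa S).
Proof.
move=> K_gt0; rewrite /core_set /bbq_sampler -ridge_nil.
by have [C [-> _ _]] := foldl_bbq_step_ridge T kappa [::] S K_gt0.
Qed.

Lemma subseq_core_set T kappa S : 0 < K -> subseq (core_set T K kappa S) S.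
Proof.
move=> K_gt0; rewrite /core_set /bbq_sampler -ridge_nil.
by have [C [-> ? _]] := foldl_bbq_step_ridge T kappa [::] S K_gt0.
Qed.

Lemma core_set_subseq_core T kappa S C : 0 < K ->
  subseq C (core_set T K kappa S) -> core_set T K kappa C = C.
Proof.
move=> K_gt0; rewrite /core_set /bbq_sampler -ridge_nil.
have [C0 [-> _ H]] := foldl_bbq_step_ridge T kappa [::] S K_gt0.
by move=> /H->.
Qed.

Lemma subseq_mdiff Q U : subseq (mdiff Q U) Q.
Proof.
elim: U Q => //= p U IH Q.
exact: subseq_trans (IH _) (rem_subseq _ _).
Qed.

(** Deletion leads to [ridge] of the surviving core points; a fresh run on these points queries all
    of them and reaches the same system. *)
Lemma state_of_system_core T kappa S U : 0 < K ->
  state_of_system T K kappa S U =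
  state_of_system T K kappa (mdiff (core_set T K kappa S) U) [::].
Proof.
move=> K_gt0; rewrite /state_of_system /alg !bbq_sampler_ridge //.
rewrite !deletion_update_ridge.
by rewrite (@core_set_subseq_core _ _ S (mdiff _ U)) // subseq_mdiff.
Qed.

End Ridge.

Theorem theorem4p1 (R : realType) (d T : nat) (K kappa : R)
    (K_gt0 : 0 < K) (kappa01 : 0 <= kappa <= 1) (G : set (set (state R d))) :
  exact_system_aware_unlearning_with (@setting R d T)
    (@state_law R d T K kappa G) (@core_set R d T K kappa) /\
  system_aware_unlearning (@setting R d T) (@state_law R d T K kappa G) 0 0.
Proof.
have exact_core : exact_system_aware_unlearning_with (@setting R d T)
    (@state_law R d T K kappa G) (@core_set R d T K kappa).
  move=> S _; split=> [|U _ F _]; first exact: subseq_core_set.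
  (* The two Dirac laws coincide, so with factor [1] and slack [0] both inequalities are
     reflexive. *)
  rewrite /state_law -state_of_system_core // expR0 mul1e adde0.
  by split.
by split=> // S /exact_core[]; exists (core_set T K kappa S).
Qed.
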